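(* Let $\mathbb{T}$ be a time scale that is unbounded above and has bounded graininess, and let $G$ be a $q\times r$ real matrix-valued function on $\mathbb{T}\times\mathbb{T}$, giving the weighting pattern $G(t,\sigma(s))$, $t,s\in\mathbb{T}$. The weighting pattern $G(t,\sigma(s))$ is realizable if and only if there exist, for some positive integer $n$, an rd-continuous matrix function $H(t)$ on $\mathbb{T}$ of dimension $q\times n$ and an rd-continuous matrix function $F(t)$ on $\mathbb{T}$ of dimension $n\times r$ such that $$G(t,\sigma(s))=H(t)F(\sigma(s))\quad\text{for all }t,s\in\mathbb{T}.$$
   Context: A time scale $\mathbb{T}$ is a nonempty closed subset of $\mathbb{R}$, with forward jump operator $\sigma(t)=\inf\{s\in\mathbb{T}:s>t\}$ and graininess $\mu(t)=\sigma(t)-t$; $f^\Delta$ denotes the delta derivative. A function is rd-continuous if it is continuous at right-dense points of $\mathbb{T}$ and has finite left limits at left-dense points. A square matrix function $A$ is regressive if $I+\mu(t)A(t)$ is invertible for all $t\in\mathbb{T}$. $\Phi_A(t,s)$ is the transition matrix: the unique solution $X(t)$ of $X^\Delta(t)=A(t)X(t)$, $X(s)=I$. A regressive linear system $$x^{\Delta}(t)=A(t)x(t)+B(t)u(t),\quad x(t_0)=0,\qquad y(t)=C(t)x(t),$$ with rd-continuous coefficients $A(t)\in\mathbb{R}^{n\times n}$, $B(t)\in\mathbb{R}^{n\times r}$, $C(t)\in\mathbb{R}^{q\times n}$ and $A$ regressive, is a realization (of dimension $n$) of the weighting pattern $G(t,\sigma(s))$ if $G(t,\sigma(s))=C(t)\Phi_A(t,\sigma(s))B(s)$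 for all $t,s\in\mathbb{T}$. The weighting pattern is realizable if it has a realization of some dimension $n$. *)

(* Defs.v *)
From HB Require Import structures.
From mathcomp Require Import all_boot all_order all_algebra.
From mathcomp Require Import all_classical all_reals all_analysis.
Set Implicit Arguments.
Unset Strict Implicit.
Unset Printing Implicit Defensive.
Import Order.TTheory GRing.Theory Num.Theory.
Import numFieldNormedType.Exports.
Local Open Scope classical_set_scope.
Local Open Scope ring_scope.

(* A function on a time scale T is represented by a total function on R whose
   values outside T are never used. *)

Definition time_scale (R : realType) (T : set R) : Prop :=
  T !=set0 /\ closed T.

Definition unbounded_above (R : realType) (T : set R) : Prop :=
  ~ has_ubound T.

(* No convention is made at a maximum of T (where the set is empty and [inf]
   returns 0), nor, for [rho], at a minimum: [right_dense] and [left_dense]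
   exclude these points. *)
Definition sigma (R : realType) (T : set R) (t : R) : R :=
  inf [set s | T s /\ t < s].

Definition rho (R : realType) (T : set R) (t : R) : R :=
  sup [set s | T s /\ s < t].

Definition mu (R : realType) (T : set R) (t : R) : R := sigma T t - t.

Definition bounded_graininess (R : realType) (T : set R) : Prop :=
  exists M : R, forall t, T t -> mu T t <= M.

Definition right_dense (R : realType) (T : set R) (t : R) : Prop :=
  [/\ T t, exists2 s, T s & t < s & sigma T t = t].

Definition left_dense (R : realType) (T : set R) (t : R) : Prop :=
  [/\ T t, exists2 s, T s & s < t & rho T t = t].

Definition rd_continuous (R : realType) (U : topologicalType) (T : set R)
    (f : R -> U) : Prop :=
  (forall t, right_dense T t -> f x @[x --> within T (nbhs t)] --> f t) /\
  (forall t, left_dense T t ->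
     exists l : U, f x @[x --> within T (t^'-)] --> l).

(* d is the delta derivative of f at t. *)
Definition is_delta_derive (R : realType) (T : set R) (f : R -> R)
    (t d : R) : Prop :=
  forall e : R, 0 < e -> \forall s \near within T (nbhs t),
    `|f (sigma T t) - f s - d * (sigma T t - s)| <= e * `|sigma T t - s|.

Definition is_delta_derive_mx (R : realType) (m n : nat) (T : set R)
    (X : R -> 'M[R]_(m, n)) (t : R) (D : 'M[R]_(m, n)) : Prop :=
  forall i j, is_delta_derive T (fun s => X s i j) t (D i j).

Definition regressive (R : realType) (n : nat) (T : set R)
    (A : R -> 'M[R]_n) : Prop :=
  forall t, T t -> 1%:M + mu T t *: A t \in unitmx.

Definition solves_matrix_ivp (R : realType) (n : nat) (T : set R)
    (A : R -> 'M[R]_n) (s : R) (X : R -> 'M[R]_n) : Prop :=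
  X s = 1%:M /\ forall t, T t -> is_delta_derive_mx T X t (A t *m X t).

(* For s in T and A rd-continuous and regressive, the solution exists and its
   values on T are unique, so neither the choice nor the default matters. *)
Definition transition_matrix (R : realType) (n : nat) (T : set R)
    (A : R -> 'M[R]_n) (t s : R) : 'M[R]_n :=
  xget (fun=> 0) [set X | solves_matrix_ivp T A s X] t.

(* The system x^Delta = A x + B u, x(t0) = 0, y = C x is given by its
   coefficients: the weighting pattern does not depend on t0. *)
Definition is_realization (R : realType) (q r n : nat) (T : set R)
    (G : R -> R -> 'M[R]_(q, r)) (A : R -> 'M[R]_n) (B : R -> 'M[R]_(n, r))
    (C : R -> 'M[R]_(q, n)) : Prop :=
  [/\ rd_continuous T A, rd_continuous T B, rd_continuous T C,
      regressive T A &
      forall t s, T t -> T s ->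
        G t (sigma T s) = C t *m transition_matrix T A t (sigma T s) *m B s].

Definition realizable (R : realType) (q r : nat) (T : set R)
    (G : R -> R -> 'M[R]_(q, r)) : Prop :=
  exists n : nat, (0 < n)%N /\
    exists (A : R -> 'M[R]_n) (B : R -> 'M[R]_(n, r)) (C : R -> 'M[R]_(q, n)),
      is_realization T G A B C.

(* Main.v *)
Require Import Defs.
From HB Require Import structures.
From mathcomp Require Import all_boot all_order all_algebra.
From mathcomp Require Import all_classical all_reals all_analysis.
From mathcomp Require Import lra.
Set Implicit Arguments.
Unset Strict Implicit.
Unset Printing Implicit Defensive.
Import Order.TTheory GRing.Theory Num.Theory.
Import numFieldNormedType.Exports.
Local Open Scope classical_set_scope.
Local Open Scope ring_scope.

(* A solution of x^Delta = A x that vanishes at one point of T vanishes on all of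
   T: forwards because a short interval halves the supremum of |x|, backwards by
   the same argument at left-dense points and by regressivity at left-scattered
   ones. Hence every solution X of the matrix equation is invertible on T and
   Phi(t, s) = X(t) X(s)^-1, which gives H = C X and F(t) = X(t)^-1 B(p t), where
   p is a right inverse of sigma. Conversely, a factorization H F is realized by
   A = 0, B = F o sigma, C = H. *)

(** * Limits of matrix-valued functions *)

Lemma cvg_mxP (S : Type) (F : set_system S) (U : topologicalType) (m n : nat)
    (f : S -> 'M[U]_(m, n)) (M : 'M[U]_(m, n)) :
  Filter F ->
  (f x @[x --> F] --> M) <-> (forall i j, f x i j @[x --> F] --> M i j).
Proof.
move=> FF; split=> [fM i j A MA|fM A [P MP sPA]].
  apply: (fM [set N | A (N i j)]).
  exists (fun i' j' => [set u | i' = i -> j' = j -> A u]) => [i' j'|N /= AN].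
    case: (pselect (i' = i /\ j' = j)) => [[-> ->]|ne].
      by apply: filterS MA => u Au.
    by apply: filterS filterT => u _ ei ej; case: ne.
  exact: AN.
have FP i j : F [set x | P i j (f x i j)] by exact: (fM i j _ (MP i j)).
apply: (@filterS _ F _ [set x | forall ij : 'I_m * 'I_n, P ij.1 ij.2 (f x ij.1 ij.2)]).
  by move=> x fx; apply: sPA => i j; exact: (fx (i, j)).
by apply: filter_forall => -[i j]; exact: FP.
Qed.

Lemma cvg_mulmx (S : Type) (F : set_system S) (R : numFieldType) (m n p : nat)
    (f : S -> 'M[R]_(m, n)) (g : S -> 'M[R]_(n, p))
    (M : 'M[R]_(m, n)) (N : 'M[R]_(n, p)) :
  Filter F -> f x @[x --> F] --> M -> g x @[x --> F] --> N ->
  f x *m g x @[x --> F] --> M *m N.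
Proof.
move=> FF /cvg_mxP fM /cvg_mxP gN; apply/cvg_mxP => i j; rewrite mxE.
under eq_fun do rewrite mxE.
by apply: cvg_big => [|k _]; [exact: add_continuous|exact: cvgM].
Qed.

Lemma cvg_det (S : Type) (F : set_system S) (R : numFieldType) (n : nat)
    (f : S -> 'M[R]_n) (M : 'M[R]_n) :
  Filter F -> f x @[x --> F] --> M -> \det (f x) @[x --> F] --> \det M.
Proof.
move=> FF /cvg_mxP fM; apply: cvg_big => [|s _]; first exact: add_continuous.
apply: cvgM; first exact: cvg_cst.
by apply: cvg_big => [|k _]; [exact: mul_continuous|exact: fM].
Qed.

(** By Cramer's formula the inverse is the adjugate divided by the determinant, and both are
    polynomial in the entries. Eventual invertibility of [f x] is what makes [invmx] agree with this
    formula along [F]. *)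
Lemma cvg_invmx (S : Type) (F : set_system S) (R : numFieldType) (n : nat)
    (f : S -> 'M[R]_n) (M : 'M[R]_n) :
  Filter F -> M \in unitmx -> (\forall x \near F, f x \in unitmx) ->
  f x @[x --> F] --> M -> invmx (f x) @[x --> F] --> invmx M.
Proof.
move=> FF uM uf fM; rewrite /invmx uM.
have detM : (\det (f x))^-1 @[x --> F] --> (\det M)^-1.
  by apply: cvgV; [rewrite -unitfE -unitmxE|exact: cvg_det].
apply: (@cvg_trans _ ((\det (f x))^-1 *: \adj (f x) @[x --> F])).
  by apply: near_eq_cvg; apply: filterS uf => x ->.
apply/cvg_mxP => i j; rewrite !mxE; under eq_fun do rewrite !mxE.
apply: cvgM => //; apply: cvgM; first exact: cvg_cst.
apply: cvg_det; apply/cvg_mxP => k l; rewrite !mxE.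
under eq_fun do rewrite !mxE.
by move/cvg_mxP : fM; exact.
Qed.

(** * Neighbourhoods in a time scale and the forward jump *)

Section time_scale.
Context {R : realType} {T : set R}.
Implicit Types s t : R.

Lemma near_withinP t (P : set R) :
  (\forall s \near within T (nbhs t), P s) <->
  exists2 d, 0 < d & forall s, T s -> `|t - s| < d -> P s.
Proof.
split=> [|[d d0 dP]].
  rewrite near_withinE => /nbhs_ballP[d /= d0 dP].
  exists d => // s Ts tsd; exact: (dP s).
rewrite near_withinE; apply/nbhs_ballP; exists d => //= s.
by rewrite -ball_normE /= => tsd Ts; exact: dP.
Qed.

Lemma near_within_leftP t (P : set R) :
  (\forall s \near within T (t^'-), P s) <->
  exists2 d, 0 < d & forall s, T s -> t - d < s -> s < t -> P s.
Proof.
split=> [|[d d0 dP]].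
  rewrite near_withinE near_withinE => /nbhs_ballP[d /= d0 dP].
  exists d => // s Ts tsd st; have tsd' : `|t - s| < d by rewrite ger0_norm; lra.
  exact: (dP s).
rewrite near_withinE near_withinE; apply/nbhs_ballP; exists d => //= s.
rewrite -ball_normE /= => tsd st Ts; apply: dP => //.
by move: tsd; rewrite ger0_norm; lra.
Qed.

Hypotheses (closedT : closed T) (unbT : ~ has_ubound T).

(** Ensures that the infimum defining [sigma T t] runs over a nonempty set, so its default value
    never occurs. *)
Lemma ts_above t : exists2 s, T s & t < s.
Proof.
apply: contrapT => nex; apply: unbT; exists t => s Ts.
by rewrite leNgt; apply/negP => ts; apply: nex; exists s.
Qed.

Let above t := [set s | T s /\ t < s].

Let above_neq0 t : above t !=set0.
Proof. by have [s Ts ts] := ts_above t; exists s. Qed.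

Let has_inf_above t : has_inf (above t).
Proof. by split; [exact: above_neq0|exists t => s [_ /ltW]]. Qed.

Lemma le_sigma t : t <= sigma T t.
Proof. by apply: lb_le_inf => [|s [_ /ltW]//]; exact: above_neq0. Qed.

Lemma sigma_le t s : T s -> t < s -> sigma T t <= s.
Proof. by move=> Ts ts; apply: ge_inf => //; exact: (has_inf_above t).2. Qed.

Lemma sigma_dense t d : sigma T t = t -> 0 < d ->
  exists s, [/\ T s, t < s & s < t + d].
Proof.
move=> st d0; have [s [Ts ts]] := inf_adherent d0 (has_inf_above t).
by rewrite -/(sigma T t) st => sd; exists s.
Qed.

Lemma ts_closed t : (forall d, 0 < d -> exists2 s, T s & `|t - s| < d) -> T t.
Proof.
move=> tT; rewrite (closure_id T).1// => A /nbhs_ballP[d /= d0 dA].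
have [s Ts tsd] := tT _ d0; exists s; split => //; apply: dA.
by rewrite -ball_normE.
Qed.

Lemma ts_sigma t : T (sigma T t).
Proof.
apply: ts_closed => d d0; have [s [Ts ts] sd] := inf_adherent d0 (has_inf_above t).
exists s => //; have := sigma_le Ts ts.
rewrite ltr_distlC -/(sigma T t) in sd *; lra.
Qed.

Lemma right_dense_sigma t : T t -> sigma T t = t -> right_dense T t.
Proof. by move=> Tt st; split => //; exact: ts_above. Qed.

End time_scale.

(** * Vanishing by small bounds, and induction along a real interval *)

Lemma eq0_le_eps (R : realFieldType) (K u : R) : 0 <= K ->
  (forall e : R, 0 < e -> `|u| <= e * K) -> u = 0.
Proof.
move=> K0 uK; apply/eqP; apply: contraT; rewrite -normr_gt0 => u0.
have K1 : 0 < K + 1 by lra.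
have := uK (`|u| / (2 * (K + 1))) (divr_gt0 u0 (mulr_gt0 (ltr0Sn R 1) K1)).
rewrite mulrAC ler_pdivlMr ?mulr_gt0//; nra.
Qed.

(** Consider the supremum of the points of [a, b] satisfying [P]: the limit hypothesis puts it in
    [P], and the step hypothesis forbids it to lie below b. With membership in [T] made part of [P],
    this is induction along a time scale. *)
Lemma sup_induction (R : realType) (P : set R) (a b : R) : a <= b -> P a ->
  (forall c, a < c <= b ->
    (forall d, 0 < d -> exists s, [/\ a <= s, P s, c - d < s & s < c]) ->
    P c) ->
  (forall c, a <= c < b -> P c -> exists s, [/\ P s, c < s & s <= b]) ->
  P b.
Proof.
move=> ab Pa Pclosed Pstep; pose E := [set s | a <= s <= b /\ P s].
have Ea : E a by split; rewrite ?lexx.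
have supE : has_sup E by split; [exists a|exists b => s [/andP[]]].
have ac : a <= sup E by exact: (ub_le_sup supE.2).
have cb : sup E <= b by apply: ge_sup; [exists a|move=> s [/andP[]]].
have Pc : P (sup E).
  have [Ec|nEc] := pselect (E (sup E)); first exact: Ec.2.
  have {}ac : a < sup E.
    by rewrite lt_neqAle ac andbT; apply/eqP => ca; apply: nEc; rewrite -ca.
  apply: Pclosed => [|d d0]; first by rewrite ac.
  have [s Es ds] := sup_adherent d0 supE; exists s.
  have [/andP[as_ _] Ps] := Es; split => //.
  rewrite lt_neqAle ub_le_sup ?andbT//; last exact: supE.2.
  by apply/eqP => sc; apply: nEc; rewrite -sc.
have [cb'|] := ltP (sup E) b; last by move=> bc; rewrite (le_anti (introT andP (conj bc cb))).
have acb : a <= sup E < b by rewrite ac.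
have [s [Ps cs sb]] := Pstep _ acb Pc.
have : s <= sup E.
  apply: (ub_le_sup supE.2); split => //; apply/andP; split => //.
  exact: le_trans ac (ltW cs).
by rewrite leNgt cs.
Qed.

(** * Delta derivatives and the mean value inequality *)

Section delta_derivative.
Context {R : realType} {T : set R}.
Hypotheses (closedT : closed T) (unbT : ~ has_ubound T).
Implicit Types (f : R -> R) (s t : R).

(** The point t belongs to each of its own neighbourhoods in [T], so the defining estimate holds at
    s = t for every e, which forces equality. *)
Lemma delta_derive_sigma f t d : T t -> is_delta_derive T f t d ->
  f (sigma T t) = f t + mu T t * d.
Proof.
move=> Tt fd; apply/eqP; rewrite -subr_eq0; apply/eqP.
apply: (@eq0_le_eps _ `|sigma T t - t|) => // e e0.
have /near_withinP[d0 d0_gt0 fe] := fd e e0.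
have := fe t Tt; rewrite subrr normr0 => /(_ d0_gt0).
by congr (`|_| <= _); rewrite /mu; lra.
Qed.

Lemma delta_derive_near f t d : T t -> is_delta_derive T f t d ->
  forall e, 0 < e -> exists2 d0, 0 < d0 & forall s, T s -> `|t - s| < d0 ->
    `|f t - f s - d * (t - s)| <= e * `|sigma T t - s|.
Proof.
move=> Tt fd e e0; have /near_withinP[d0 d0_gt0 fe] := fd e e0.
exists d0 => // s Ts /(fe s Ts); rewrite (delta_derive_sigma Tt fd).
by congr (`|_| <= _); rewrite /mu; lra.
Qed.

Lemma delta_derive_cvg f t d : T t -> is_delta_derive T f t d ->
  f x @[x --> within T (nbhs t)] --> f t.
Proof.
move=> Tt fd; apply/cvgrPdist_le => e e0.
have mu0 : 0 <= mu T t by rewrite subr_ge0 le_sigma.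
(* The increment splits into an error term and a linear term. Within distance 1 of t, the distance
   from s to [sigma T t] is at most [mu T t + 1], so [e'] makes the error at most e / 2; [d1] below
   does the same for the linear term. *)
pose e' := e / (2 * (mu T t + 1)).
have e'0 : 0 < e' by apply: divr_gt0 => //; lra.
have [d0 d0_gt0 fe] := delta_derive_near Tt fd e'0.
pose d1 := e / (2 * (`|d| + 1)).
have d1_gt0 : 0 < d1 by apply: divr_gt0 => //; have := normr_ge0 d; lra.
apply/near_withinP; exists (Num.min d0 (Num.min 1 d1)).
  by rewrite !lt_min d0_gt0 ltr01.
move=> s Ts; rewrite !lt_min => /and3P[/(fe _ Ts) fs ts1 tsd].
have -> : f t - f s = (f t - f s - d * (t - s)) + d * (t - s) by lra.
apply: (le_trans (ler_normD _ _)).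
have : e' * `|sigma T t - s| <= e' * (mu T t + 1).
  rewrite ler_pM2l// (_ : _ - s = mu T t + (t - s)); last by rewrite /mu; lra.
  by apply: (le_trans (ler_normD _ _)); rewrite (ger0_norm mu0) lerD2l ltW.
have : e' * (2 * (mu T t + 1)) = e by rewrite mulfVK//; apply: lt0r_neq0; lra.
have : `|d * (t - s)| <= (`|d| + 1) * d1.
  by rewrite normrM; apply: ler_pM => //; [lra|exact: ltW].
have : d1 * (2 * (`|d| + 1)) = e.
  by rewrite mulfVK//; apply: lt0r_neq0; have := normr_ge0 d; lra.
lra.
Qed.

(** Induction along [T] with the slightly larger slope L + e: limits pass by continuity, a
    right-scattered point is crossed by the exact jump formula, and at a right-dense point the extra
    e absorbs the error in the derivative estimate. *)
Lemma delta_mean_value f (f' : R -> R) (L a b : R) :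
  T a -> T b -> a <= b -> 0 <= L ->
  (forall t, T t -> is_delta_derive T f t (f' t)) ->
  (forall t, T t -> a <= t < b -> `|f' t| <= L) ->
  `|f b - f a| <= L * (b - a).
Proof.
move=> Ta Tb ab L0 fd fL; apply/ler_addgt0Pr => e0 e0_gt0.
have ba1 : 0 < b - a + 1 by lra.
(* Chosen so that e * (b - a) <= e0; the added 1 covers the case a = b. *)
pose e := e0 / (b - a + 1); have e_gt0 : 0 < e by exact: divr_gt0.
have ee : e * (b - a + 1) = e0 by rewrite /e mulfVK// gt_eqF.
suff : T b /\ `|f b - f a| <= (L + e) * (b - a) by case=> _; nra.
apply: (@sup_induction _ (fun t => T t /\ `|f t - f a| <= (L + e) * (t - a)) a b) => //.
- by rewrite !subrr normr0 mulr0.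
- move=> c /andP[ac cb] near_c; have Tc : T c.
    apply: (ts_closed closedT) => d /near_c[s [_ [Ts _] ds sc]].
    by exists s => //; rewrite ger0_norm; lra.
  split => //; apply/ler_addgt0Pr => h h0.
  have /cvgrPdist_le/(_ h h0)/near_withinP[d d0 fs] := delta_derive_cvg Tc (fd c Tc).
  have [s [_ [Ts fsa] ds sc]] := near_c d d0.
  have /(fs s Ts) fcs : `|c - s| < d by rewrite ger0_norm; lra.
  have -> : f c - f a = (f c - f s) + (f s - f a) by lra.
  apply: (le_trans (ler_normD _ _)).
  have : (L + e) * (s - a) <= (L + e) * (c - a) by rewrite ler_pM2l; lra.
  lra.
- move=> c /andP[ac cb] [Tc fca].
  have fLc : `|f' c| <= L by apply: fL => //; rewrite ac.
  have [sc|sc] := eqVneq (sigma T c) c; last first.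
    have csc : c < sigma T c by rewrite lt_neqAle eq_sym sc le_sigma.
    exists (sigma T c); split => //; last exact: sigma_le.
    split; first exact: ts_sigma.
    rewrite (delta_derive_sigma Tc (fd c Tc)).
    have -> : f c + mu T c * f' c - f a = (f c - f a) + mu T c * f' c by lra.
    apply: (le_trans (ler_normD _ _)); rewrite normrM gtr0_norm ?subr_gt0//.
    by rewrite /mu; nra.
  have [d d0 fs] := delta_derive_near Tc (fd c Tc) e_gt0.
  have m0 : 0 < Num.min d (b - c) by rewrite lt_min d0; lra.
  have [s [Ts cs]] := sigma_dense unbT sc m0.
  rewrite -ltrBlDl lt_min => /andP[sd sb].
  exists s; split => //; last lra.
  split => //.
  have cs' : `|c - s| = s - c by rewrite ler0_norm; lra.
  have := fs s Ts; rewrite sc cs' => /(_ sd) {}fs.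
  have -> : f s - f a = (f c - f a) - (f c - f s - f' c * (c - s)) - f' c * (c - s) by lra.
  apply: (le_trans (ler_normB _ _)); rewrite normrM cs'.
  apply: (le_trans (lerD (ler_normB _ _) (lexx _))).
  by nra.
Qed.

End delta_derivative.

(** * Uniqueness for homogeneous linear systems *)

Lemma cvg_mx_bounded (S : Type) (F : set_system S) (R : realFieldType)
    (m n : nat) (f : S -> 'M[R]_(m, n)) (M : 'M[R]_(m, n)) {FF : Filter F} :
  f x @[x --> F] --> M ->
  exists2 K, 0 <= K & \forall x \near F, forall i j, `|f x i j| <= K.
Proof.
(* The sum serves as one bound for all entries: each summand already bounds its own entry
   eventually, and the others are nonnegative. *)
move=> /cvg_mxP fM; exists (\sum_i \sum_j (`|M i j| + 1)).
  by apply: sumr_ge0 => i _; apply: sumr_ge0 => j _; rewrite addr_ge0.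
apply: filter_forall => i; apply: filter_forall => j.
have Mij : `|M i j| < `|M i j| + 1 by rewrite ltrDl.
apply: filterS (cvgr_norm_le _ (fM i j) _ Mij) => x /le_trans; apply.
rewrite (bigD1 i)//= (bigD1 j)//= -addrA lerDl addr_ge0//.
  by apply: sumr_ge0 => k _; rewrite addr_ge0.
by apply: sumr_ge0 => k _; apply: sumr_ge0 => l _; rewrite addr_ge0.
Qed.

Lemma mulmx_entry_le (R : realFieldType) (m n p : nat) (A : 'M[R]_(m, n))
    (B : 'M[R]_(n, p)) (K M : R) i j :
  (forall k, `|A i k| <= K) -> (forall k, `|B k j| <= M) ->
  `|(A *m B) i j| <= n%:R * (K * M).
Proof.
move=> AK BM; rewrite mxE; apply: (le_trans (ler_norm_sum _ _ _)).
rewrite -[n in n%:R]card_ord mulr_natl -sumr_const ler_sum// => k _.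
by rewrite normrM ler_pM.
Qed.

Section linear_systems.
Context {R : realType} {T : set R}.
Hypotheses (closedT : closed T) (unbT : ~ has_ubound T).
Implicit Types s t : R.

Lemma delta_derive_mx_sigma (m n : nat) (X : R -> 'M[R]_(m, n)) t D :
  T t -> is_delta_derive_mx T X t D -> X (sigma T t) = X t + mu T t *: D.
Proof.
move=> Tt XD; apply/matrixP => i j; rewrite !mxE.
exact: delta_derive_sigma (XD i j).
Qed.

Lemma delta_derive_mx_cvg (m n : nat) (X : R -> 'M[R]_(m, n)) t D :
  T t -> is_delta_derive_mx T X t D -> X x @[x --> within T (nbhs t)] --> X t.
Proof.
by move=> Tt XD; apply/cvg_mxP => i j; exact: (delta_derive_cvg unbT Tt (XD i j)).
Qed.

Section homogeneous.
Context (n p : nat) (A : R -> 'M[R]_n) (x : R -> 'M[R]_(n, p)).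
Hypothesis xA : forall t, T t -> is_delta_derive_mx T x t (A t *m x t).

(* The mean value inequality bounds the supremum of |x| on the short interval
   [u, v] by half of itself. *)
Lemma vanish_near (u v c K M : R) :
  (v - u) * (n%:R * K) <= 1 / 2 -> 0 <= K ->
  T c -> u <= c <= v -> x c = 0 ->
  (forall s i j, T s -> u <= s < v -> `|A s i j| <= K) ->
  (forall s i j, T s -> u <= s <= v -> `|x s i j| <= M) ->
  forall s, T s -> u <= s <= v -> x s = 0.
Proof.
move=> uvK K0 Tc ucv xc AK xM s0 Ts0 us0v.
pose E := [set y | exists s i j, [/\ T s, u <= s <= v & y = `|x s i j|]].
apply/matrixP => i0 j0; rewrite mxE; apply/eqP; rewrite -normr_le0.
have E0 : E `|x s0 i0 j0| by exists s0, i0, j0.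
have supE : has_sup E.
  by split; [by exists `|x s0 i0 j0| | exists M => _ [s [i [j [Ts usv ->]]]]; exact: xM].
have le_supE s i j : T s -> u <= s <= v -> `|x s i j| <= sup E.
  by move=> Ts usv; apply: (ub_le_sup supE.2); exists s, i, j.
have S0 : 0 <= sup E by exact: le_trans (normr_ge0 _) (le_supE _ i0 j0 Ts0 us0v).
suff half : sup E <= sup E / 2 by have := le_supE _ i0 j0 Ts0 us0v; lra.
apply: ge_sup => [|_ [s [i [j [Ts usv ->]]]]]; first by exists `|x s0 i0 j0|.
pose L := n%:R * (K * sup E).
have L0 : 0 <= L by rewrite /L mulr_ge0// mulr_ge0.
have Lhalf : L * (v - u) <= sup E / 2.
  rewrite (_ : L * _ = (v - u) * (n%:R * K) * sup E); last by rewrite /L; lra.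
  by rewrite [leRHS]mulrC ler_wpM2r//; lra.
have AxL t : T t -> u <= t < v -> `|(A t *m x t) i j| <= L.
  move=> Tt /andP[ut tv]; apply: mulmx_entry_le => k.
    by apply: AK; rewrite ?ut.
  by apply: le_supE; rewrite ?ut ?ltW.
have xd t : T t -> is_delta_derive T (fun s => x s i j) t ((A t *m x t) i j).
  by move=> Tt; exact: xA.
move: usv ucv => /andP[us sv] /andP[uc cv].
have [cs|/ltW sc] := leP c s.
  have := delta_mean_value closedT unbT Tc Ts cs L0 xd.
  rewrite xc mxE subr0 => H; apply: (le_trans (H _)) => [t Tt /andP[ct ts]|].
    by apply: AxL => //; apply/andP; split; lra.
  by apply: le_trans Lhalf; rewrite ler_wpM2l//; lra.
have := delta_mean_value closedT unbT Ts Tc sc L0 xd.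
rewrite xc mxE sub0r normrN => H; apply: (le_trans (H _)) => [t Tt /andP[ct ts]|].
  by apply: AxL => //; apply/andP; split; lra.
by apply: le_trans Lhalf; rewrite ler_wpM2l//; lra.
Qed.

Hypothesis rdA : rd_continuous T A.

(** Closedness of [T] together with continuity of x; this is the limit step of both inductions
    below. *)
Lemma homogeneous_closed c : (forall d, 0 < d -> exists s, [/\ T s, x s = 0 & `|c - s| < d]) ->
  T c /\ x c = 0.
Proof.
move=> near_c; have Tc : T c.
  by apply: (ts_closed closedT) => d /near_c[s []]; exists s.
split => //; apply/matrixP => i j; rewrite mxE; apply/eqP.
rewrite -normr_le0; apply/ler_addgt0Pl => e e0; rewrite addr0.
have /cvgrPdist_le/(_ e e0)/near_withinP[d d0 xe] :=
  delta_derive_cvg unbT Tc (xA Tc i j).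
by have [s [Ts xs /(xe s Ts)]] := near_c d d0; rewrite xs mxE subr0.
Qed.

(** Supplies an interval length for [vanish_near], inside the radii where A and x are bounded.
    Halving the minimum makes the inequalities with [d1] and [d2] strict. *)
Lemma short_length (K d1 d2 : R) : 0 <= K -> 0 < d1 -> 0 < d2 ->
  exists2 d, 0 < d & [/\ d < d1, d < d2 & d * (n%:R * K) <= 1 / 2].
Proof.
move=> K0 d10 d20; have nK : 0 <= n%:R * K by rewrite mulr_ge0.
pose d3 := 1 / (2 * (n%:R * K + 1)).
have d30 : 0 < d3 by apply: divr_gt0 => //; lra.
have d3E : d3 * (2 * (n%:R * K + 1)) = 1.
  by rewrite mulfVK//; apply: lt0r_neq0; lra.
have [m0 [md1 [md2 md3]]] : 0 < Num.min d1 (Num.min d2 d3) /\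
    Num.min d1 (Num.min d2 d3) <= d1 /\ Num.min d1 (Num.min d2 d3) <= d2 /\
    Num.min d1 (Num.min d2 d3) <= d3.
  by rewrite !lt_min !ge_min !lexx d10 d20 d30 !orbT.
exists (Num.min d1 (Num.min d2 d3) / 2); first lra.
split; [lra|lra|].
by move: (Num.min _ _) m0 md1 md2 md3 => m m0 _ _ md3; nra.
Qed.

(** At a right-scattered point the jump formula carries the zero over to [sigma T c]. At a
    right-dense point A is continuous, hence bounded nearby, and [vanish_near] applies on a short
    interval to the right. *)
Lemma homogeneous_zero_forward (a b : R) : T a -> T b -> a <= b ->
  x a = 0 -> x b = 0.
Proof.
move=> Ta Tb ab xa; suff [] : T b /\ x b = 0 by [].
apply: (@sup_induction _ (fun t => T t /\ x t = 0) a b) => //.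
  move=> c _ near_c; apply: homogeneous_closed => d /near_c[s [_ [Ts xs] ds sc]].
  by exists s; split => //; rewrite ger0_norm; lra.
move=> c /andP[ac cb] [Tc xc].
have [sc|sc] := eqVneq (sigma T c) c; last first.
  exists (sigma T c); split; last exact: sigma_le.
    split; first exact: ts_sigma.
    by rewrite (delta_derive_mx_sigma Tc (xA Tc)) xc mulmx0 scaler0 addr0.
  by rewrite lt_neqAle eq_sym sc le_sigma.
have [K K0 /near_withinP[d1 d10 AK]] :=
  cvg_mx_bounded (rdA.1 _ (right_dense_sigma unbT Tc sc)).
have [M _ /near_withinP[d2 d20 xM]] :=
  cvg_mx_bounded (delta_derive_mx_cvg Tc (xA Tc)).
have [d d0 [dd1 dd2 dK]] := short_length K0 d10 d20.
have m0 : 0 < Num.min d (b - c) by rewrite lt_min d0; lra.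
have [s [Ts cs]] := sigma_dense unbT sc m0.
rewrite -ltrBlDl lt_min => /andP[sd sb].
exists s; split => //; last lra.
split => //; apply: (@vanish_near c (c + d) c K M) => //.
- by rewrite (_ : c + d - c = d)//; lra.
- by apply/andP; split; lra.
- move=> t i j Tt /andP[ct td]; apply: AK => //.
  by rewrite ler0_norm; lra.
- move=> t i j Tt /andP[ct td]; apply: xM => //.
  by rewrite ler0_norm; lra.
- by apply/andP; split; lra.
Qed.

Hypothesis regA : regressive T A.

(** At a left-scattered c the predecessor satisfies x(c) = (I + mu A) x(rho c), and regressivity
    cancels the factor. At a left-dense c the left limit of A provides the bound needed by
    [vanish_near]. *)
Lemma homogeneous_zero_backward (a b : R) : T a -> T b -> b <= a ->
  x a = 0 -> x b = 0.
Proof.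
(* The reflection t -> -t turns the descent from a to b into an ascent, to which [sup_induction]
   applies. *)
move=> Ta Tb ba xa; suff [] : T (- (- b)) /\ x (- (- b)) = 0 by rewrite opprK.
apply: (@sup_induction _ (fun t => T (- t) /\ x (- t) = 0) (- a) (- b)).
- by rewrite lerN2.
- by rewrite opprK.
- move=> c _ near_c; apply: homogeneous_closed => d /near_c[s [_ [Ts xs] ds sc]].
  by exists (- s); split => //; rewrite ler0_norm; lra.
move=> c'; rewrite -[c']opprK; move: (- c') => c /andP[].
rewrite lerN2 ltrN2 !opprK => ca bc [Tc xc].
suff [s [Ts xs bs sc]] : exists s, [/\ T s, x s = 0, b <= s & s < c].
  by exists (- s); rewrite !opprK ltrN2 lerN2.
pose E := [set s | T s /\ s < c].
have supE : has_sup E by split; [exists b|exists c => s [_ /ltW]].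
have rhoE : sup E = rho T c by [].
have rc : rho T c <= c by apply: ge_sup; [exact: supE.1|move=> s [_ /ltW]].
have br : b <= rho T c by exact: (ub_le_sup supE.2).
have rho_le s : T s -> s < c -> s <= rho T c.
  by move=> Ts sc; apply: (ub_le_sup supE.2).
have [{}rc|nrc] := eqVneq (rho T c) c; last first.
  have {}rc : rho T c < c by rewrite lt_neqAle nrc.
  have Tr : T (rho T c).
    apply: (ts_closed closedT) => d d0; have [s Es ds] := sup_adherent d0 supE.
    exists s; first exact: Es.1.
    have := rho_le _ Es.1 Es.2; rewrite rhoE in ds; rewrite ltr_distlC; lra.
  (* If [sigma T (rho T c)] were below c, it would be a point of [T] at most [rho T c], hence equal
     to it; then [T] would have points strictly between [rho T c] and c. *)
  have sr : sigma T (rho T c) = c.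
    apply/eqP; rewrite eq_le sigma_le//=; rewrite leNgt; apply/negP => sc.
    have := rho_le _ (ts_sigma closedT unbT _) sc.
    have := le_sigma unbT (rho T c) => h1 h2.
    have e : sigma T (rho T c) = rho T c by lra.
    have cr : 0 < c - rho T c by lra.
    have [s [Ts rs sc']] := sigma_dense unbT e cr.
    by have := rho_le s Ts; lra.
  exists (rho T c); split => //.
  have := delta_derive_mx_sigma Tr (xA Tr).
  rewrite sr xc scalemxAl -[X in X + _]mul1mx -mulmxDl => /esym e.
  by rewrite -[x _](mulKmx (regA Tr)) e mulmx0.
have ldc : left_dense T c by split => //; exists b.
have [l Al] := rdA.2 _ ldc.
have [K K0 /near_within_leftP[d1 d10 AK]] := cvg_mx_bounded Al.
have [M _ /near_withinP[d2 d20 xM]] :=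
  cvg_mx_bounded (delta_derive_mx_cvg Tc (xA Tc)).
have [d d0 [dd1 dd2 dK]] := short_length K0 d10 d20.
have m0 : 0 < Num.min d (c - b) by rewrite lt_min d0; lra.
have [s Es] := sup_adherent m0 supE; rewrite rhoE rc => cs.
have [sd sb] : c - d < s /\ b < s.
  have : Num.min d (c - b) <= d /\ Num.min d (c - b) <= c - b.
    by rewrite !ge_min !lexx orbT.
  lra.
have [Ts sc] := Es; exists s; split => //; last lra.
apply: (@vanish_near (c - d) c c K M) => //.
- by rewrite (_ : c - (c - d) = d)//; lra.
- by apply/andP; split; lra.
(* The left limit bounds A only strictly before c and says nothing about A(c); this is why
   [vanish_near] asks for the bound on a half-open interval. *)
- move=> t i j Tt /andP[ct td]; apply: AK => //; lra.
- move=> t i j Tt /andP[ct td]; apply: xM => //.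
  by rewrite ger0_norm; lra.
- by apply/andP; split; lra.
Qed.

Lemma homogeneous_zero (a b : R) : T a -> T b -> x a = 0 -> x b = 0.
Proof.
move=> Ta Tb; have [ab|/ltW ba] := leP a b.
  exact: homogeneous_zero_forward.
exact: homogeneous_zero_backward.
Qed.

End homogeneous.
End linear_systems.

(** * Matrix solutions and the transition matrix *)

Lemma delta_derive_mx_mulr (R : realType) (T : set R) (m n p : nat)
    (X : R -> 'M[R]_(m, n)) (M : 'M[R]_(n, p)) (t : R) (D : 'M[R]_(m, n)) :
  is_delta_derive_mx T X t D ->
  is_delta_derive_mx T (fun s => X s *m M) t (D *m M).
Proof.
move=> XD i j e e0; pose S := \sum_k `|M k j|.
have S0 : 0 <= S by apply: sumr_ge0.
(* The tolerance is shared among the terms of the product through [S], the absolute sum of column j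
   of M; the added 1 avoids division by zero. *)
have e'0 : 0 < e / (S + 1) by apply: divr_gt0 => //; lra.
have near_k : \forall s \near within T (nbhs t), forall k,
    `|X (sigma T t) i k - X s i k - D i k * (sigma T t - s)| <=
      e / (S + 1) * `|sigma T t - s|.
  by apply: filter_forall => k; exact: XD.
apply: filterS near_k => s Xs.
rewrite !mxE mulr_suml -!sumrB.
apply: (@le_trans _ _ (\sum_k (e / (S + 1) * `|sigma T t - s|) * `|M k j|)).
  apply: (le_trans (ler_norm_sum _ _ _)); apply: ler_sum => k _.
  rewrite mulrAC -!mulrBl normrM ler_wpM2r//; exact: Xs.
rewrite -mulr_sumr -/S mulrAC ler_wpM2r// mulrAC ler_pdivrMr; lra || nra.
Qed.

Lemma delta_derive_mxB (R : realType) (T : set R) (m n : nat)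
    (X Y : R -> 'M[R]_(m, n)) (t : R) (D E : 'M[R]_(m, n)) :
  is_delta_derive_mx T X t D -> is_delta_derive_mx T Y t E ->
  is_delta_derive_mx T (fun s => X s - Y s) t (D - E).
Proof.
move=> XD YE i j e e0; have e2 : 0 < e / 2 by lra.
apply: filterS2 (XD i j _ e2) (YE i j _ e2) => s Xs Ys; rewrite !mxE.
pose rX := X (sigma T t) i j - X s i j - D i j * (sigma T t - s).
pose rY := Y (sigma T t) i j - Y s i j - E i j * (sigma T t - s).
rewrite [X in `|X|](_ : _ = rX - rY); last by rewrite /rX /rY; lra.
by apply: (le_trans (ler_normB _ _)); rewrite -/rX -/rY in Xs Ys; lra.
Qed.

Section transition.
Context {R : realType} {T : set R}.
Hypotheses (closedT : closed T) (unbT : ~ has_ubound T).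
Context (n : nat) (A : R -> 'M[R]_n).
Hypotheses (rdA : rd_continuous T A) (regA : regressive T A).
Context (s0 : R) (X : R -> 'M[R]_n).
Hypotheses (Ts0 : T s0) (solX : solves_matrix_ivp T A s0 X).

Lemma solution_mulr_delta (p : nat) (M : 'M[R]_(n, p)) t : T t ->
  is_delta_derive_mx T (fun s => X s *m M) t (A t *m (X t *m M)).
Proof. by move=> Tt; rewrite mulmxA; apply: delta_derive_mx_mulr; exact: solX.2. Qed.

(** If X(t) killed a nonzero vector v, then X v would be a solution vanishing at t, hence also at
    [s0], where it equals v. *)
Lemma solution_unitmx t : T t -> X t \in unitmx.
Proof.
(* [det0P] yields a row vector in the left kernel, so it is applied to the transpose. *)
move=> Tt; apply: contraT; rewrite unitmxE unitfE negbK -det_tr.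
move=> /det0P[v v0 /(congr1 trmx)]; rewrite trmx_mul trmxK trmx0 => Xv.
have := homogeneous_zero closedT unbT (@solution_mulr_delta _ v^T) rdA regA Tt Ts0 Xv.
by rewrite solX.1 mul1mx => /(congr1 trmx); rewrite trmxK trmx0 => /eqP; rewrite (negPf v0).
Qed.

(** X(.) X(s)^-1 solves the problem with initial point s, so [xget] returns a genuine solution; the
    difference of the two vanishes at s, hence on [T]. *)
Lemma transition_matrixE t s : T t -> T s ->
  transition_matrix T A t s = X t *m invmx (X s).
Proof.
move=> Tt Ts; have sXs : solves_matrix_ivp T A s (fun t => X t *m invmx (X s)).
  split; first by rewrite mulmxV// solution_unitmx.
  by move=> u Tu; exact: solution_mulr_delta.
rewrite /transition_matrix; set Y := xget _ _.
have [Ys Yd] : solves_matrix_ivp T A s Y by apply: xgetPex; exists (fun t => X t *m invmx (X s)).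
apply/eqP; rewrite -subr_eq0; apply/eqP.
apply: (homogeneous_zero closedT unbT (x := fun t => Y t - X t *m invmx (X s)) _ rdA regA Ts Tt).
  by move=> u Tu; rewrite mulmxBr; apply: delta_derive_mxB; [exact: Yd|exact: sXs.2].
by rewrite Ys sXs.1 subrr.
Qed.

End transition.

(** * Stability of rd-continuity, and a section of the forward jump *)

Lemma rd_continuous_cst (R : realType) (U : topologicalType) (T : set R)
  (u : U) : rd_continuous T (fun=> u).
Proof. by split=> [t _|t _]; [|exists u]; exact: cvg_cst. Qed.

(** Continuity along [T] makes f(t) itself the left limit. This serves for a matrix solution and its
    inverse. *)
Lemma rd_continuous_cvg (R : realType) (U : topologicalType) (T : set R)
    (f : R -> U) :
  (forall t, T t -> f x @[x --> within T (nbhs t)] --> f t) ->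
  rd_continuous T f.
Proof.
move=> fT; split=> [t [Tt _ _]|t [Tt _ _]]; first exact: fT.
exists (f t) => P /(fT t Tt) /near_withinP[d d0 dP].
apply/near_within_leftP; exists d => // s Ts ds st; apply: dP => //.
by rewrite ger0_norm; lra.
Qed.

Lemma rd_continuous_mulmx (R : realType) (T : set R) (m n p : nat)
    (f : R -> 'M[R]_(m, n)) (g : R -> 'M[R]_(n, p)) :
  rd_continuous T f -> rd_continuous T g -> rd_continuous T (fun t => f t *m g t).
Proof.
move=> [fr fl] [gr gl]; split=> [t dt|t dt].
  by apply: cvg_mulmx; [exact: fr|exact: gr].
have [lf flt] := fl t dt; have [lg glt] := gl t dt.
by exists (lf *m lg); exact: cvg_mulmx.
Qed.

Lemma left_dense_near (R : realType) (T : set R) t d : left_dense T t -> 0 < d ->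
  exists s, [/\ T s, t - d < s & s < t].
Proof.
move=> [Tt [s Ts st] rt] d0; have supE : has_sup [set s | T s /\ s < t].
  by split; [exists s|exists t => u [_ /ltW]].
have [u [Tu ut]] := sup_adherent d0 supE; rewrite -/(rho T t) rt => du.
by exists u.
Qed.

(* phi moves a point of T no farther than to its neighbours in T. *)
Lemma rd_continuous_shift (R : realType) (U : topologicalType) (T : set R)
    (f : R -> U) (phi : R -> R) :
  ~ has_ubound T -> rd_continuous T f -> (forall s, T s -> T (phi s)) ->
  (forall s u, T s -> T u -> s < u -> phi s <= u) ->
  (forall s u, T s -> T u -> u < s -> u <= phi s) ->
  (forall t, right_dense T t -> phi t = t) ->
  rd_continuous T (fun t => f (phi t)).
Proof.
move=> unbT [fr fl] Tphi phi_le le_phi phi_rd; split=> [t rt|t lt_].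
  rewrite phi_rd//; apply: (@cvg_comp _ _ _ phi f _ (within T (nbhs t))); last exact: fr.
  move=> P /near_withinP[d d0 dP]; apply/near_withinP.
  have [Tt _ st] := rt; have [u [Tu tu ud]] := sigma_dense unbT st d0.
  have right x : T x -> t <= x -> x < u -> t <= phi x <= u.
    move=> Tx; rewrite le_eqVlt => /predU1P[<- _|tx xu].
      by rewrite phi_rd// lexx ltW.
    by rewrite le_phi// phi_le.
  (* A point v of [T] just left of t bounds [phi x] from below for x in (v, t); without such a v, no
     x within d lies left of t. *)
  have [[v [Tv dv vt]]|nv] := pselect (exists v, [/\ T v, t - d < v & v < t]).
    exists (Num.min (u - t) (t - v)); first by rewrite lt_min !subr_gt0 tu.
    move=> x Tx; rewrite lt_min !ltr_distlC => /andP[/andP[_ xu] /andP[vx _]].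
    apply: dP; first exact: Tphi.
    rewrite ltr_distlC; have [tx|xt] := leP t x.
      by have := right x Tx tx; lra.
    have := phi_le x t Tx Tt xt; have := le_phi x v Tx Tv; lra.
  exists (Num.min (u - t) d); first by rewrite lt_min subr_gt0 tu.
  move=> x Tx; rewrite lt_min !ltr_distlC => /andP[/andP[_ xu] /andP[dx _]].
  apply: dP; first exact: Tphi.
  rewrite ltr_distlC; have [tx|xt] := leP t x; last by case: nv; exists x.
  by have := right x Tx tx; lra.
have [l fl_l] := fl t lt_; exists l.
apply: (@cvg_comp _ _ _ phi f _ (within T (t^'-))) fl_l.
move=> P /near_within_leftP[d d0 dP]; apply/near_within_leftP.
have [v [Tv dv vt]] := left_dense_near lt_ d0.
exists (t - v); first by rewrite subr_gt0.
move=> x Tx vx xt; have xt0 : 0 < t - x by lra.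
(* A further point w between x and t gives [phi x] <= w < t, so [phi x] stays strictly left of t. *)
have [w [Tw xw wt]] := left_dense_near lt_ xt0.
have := phi_le x w Tx Tw; have := le_phi x v Tx Tv => H1 H2.
by apply: dP; [exact: Tphi| |]; lra.
Qed.

(* A right inverse of sigma on its range, fixing the right-dense points so that
   it preserves rd-continuity. *)
Definition sigma_section (R : realType) (T : set R) (t : R) : R :=
  if sigma T t == t then t else xget t [set s | T s /\ sigma T s = t].

Section sigma_section.
Context {R : realType} {T : set R}.
Hypotheses (closedT : closed T) (unbT : ~ has_ubound T).
Implicit Types s t : R.

Lemma sigma_section_spec t : T t -> T (sigma_section T t) /\
  (sigma_section T t = t \/ sigma T (sigma_section T t) = t).
Proof.
move=> Tt; rewrite /sigma_section; case: ifP => _; first by split; [|left].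
by case: xgetP => [s _ [Ts st]|_]; [split; [|right]|split; [|left]].
Qed.

Lemma sigma_sectionK t : T t -> sigma T (sigma_section T (sigma T t)) = sigma T t.
Proof.
move=> Tt; rewrite /sigma_section; case: ifP => [/eqP//|_].
have ex : exists s, [set s | T s /\ sigma T s = sigma T t] s by exists t.
by have [] := xgetPex (sigma T t) ex.
Qed.

Lemma rd_continuous_sigma (U : topologicalType) (f : R -> U) :
  rd_continuous T f -> rd_continuous T (fun t => f (sigma T t)).
Proof.
move=> rdf; apply: (rd_continuous_shift unbT rdf).
- by move=> s _; exact: ts_sigma.
- by move=> s u _; exact: sigma_le.
- by move=> s u _ _ us; exact: le_trans (ltW us) (le_sigma unbT s).
- by move=> t [].
Qed.

Lemma rd_continuous_sigma_section (U : topologicalType) (f : R -> U) :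
  rd_continuous T f -> rd_continuous T (fun t => f (sigma_section T t)).
Proof.
move=> rdf; apply: (rd_continuous_shift unbT rdf).
- by move=> s /sigma_section_spec[].
- move=> s u Ts _ su; have [_ [->|ss]] := sigma_section_spec Ts; first exact: ltW.
  by apply: ltW; apply: le_lt_trans su; rewrite -[leRHS]ss le_sigma.
- move=> s u Ts Tu us; have [_ [->|ss]] := sigma_section_spec Ts; first exact: ltW.
  rewrite leNgt; apply/negP => /(sigma_le unbT Tu).
  by rewrite ss leNgt us.
- by move=> t [_ _ st]; rewrite /sigma_section st eqxx.
Qed.

End sigma_section.

(** * The two directions of the equivalence *)

Lemma realizable_of_factorization (R : realType) (T : set R) (q r n : nat)
    (G : R -> R -> 'M[R]_(q, r)) (H : R -> 'M[R]_(q, n)) (F : R -> 'M[R]_(n, r)) :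
  closed T -> ~ has_ubound T -> rd_continuous T H -> rd_continuous T F ->
  (forall t s, T t -> T s -> G t (sigma T s) = H t *m F (sigma T s)) ->
  is_realization T G (fun=> 0) (fun s => F (sigma T s)) H.
Proof.
move=> cT uT rdH rdF GHF.
have rd0 : rd_continuous T (fun=> 0 : 'M[R]_n) by exact: rd_continuous_cst.
have reg0 : regressive T (fun=> 0 : 'M[R]_n).
  by move=> t _; rewrite scaler0 addr0 unitmx1.
split => //; first exact: rd_continuous_sigma.
move=> t s Tt Ts; rewrite GHF//.
have sol1 : solves_matrix_ivp T (fun=> 0) t (fun=> 1%:M : 'M[R]_n).
  split => // u _ i j e e0; apply: filterE => v.
  by rewrite subrr mul0mx [X in X * (_ - v)]mxE mul0r subrr normr0 mulr_ge0// ltW.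
rewrite (transition_matrixE cT uT rd0 reg0 Tt sol1)//; last exact: ts_sigma.
by rewrite invmx1 !mulmx1.
Qed.

Lemma factorization_of_realization (R : realType) (T : set R) (q r n : nat)
    (G : R -> R -> 'M[R]_(q, r)) (A : R -> 'M[R]_n) (B : R -> 'M[R]_(n, r))
    (C : R -> 'M[R]_(q, n)) :
  closed T -> ~ has_ubound T -> is_realization T G A B C ->
  exists (H : R -> 'M[R]_(q, n)) (F : R -> 'M[R]_(n, r)),
    [/\ rd_continuous T H, rd_continuous T F &
        forall t s, T t -> T s -> G t (sigma T s) = H t *m F (sigma T s)].
Proof.
move=> cT uT [rdA rdB rdC regA GE].
(* If no matrix solution exists, the transition matrix is its default value 0
   and the zero factorization works: no existence theorem is needed. *)
have [[s0 [X [Ts0 solX]]]|nosol] :=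
    pselect (exists s0 X, T s0 /\ solves_matrix_ivp T A s0 X); last first.
  exists (fun=> 0), (fun=> 0); split; [exact: rd_continuous_cst..|].
  move=> t s Tt Ts; rewrite GE// /transition_matrix xgetPN ?mulmx0 ?mul0mx//.
  by move=> X solX; apply: nosol; exists (sigma T s), X; split => //; exact: ts_sigma.
have Xcvg t : T t -> X x @[x --> within T (nbhs t)] --> X t.
  by move=> Tt; exact: (delta_derive_mx_cvg uT Tt (solX.2 t Tt)).
have Xunit := solution_unitmx cT uT rdA regA Ts0 solX.
exists (fun t => C t *m X t), (fun t => invmx (X t) *m B (sigma_section T t)); split.
- by apply: rd_continuous_mulmx => //; exact: rd_continuous_cvg.
- apply: rd_continuous_mulmx; last exact: rd_continuous_sigma_section.
  apply: rd_continuous_cvg => t Tt; apply: cvg_invmx; [exact: Xunit| |exact: Xcvg].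
  by apply/near_withinP; exists 1 => // s Ts _; exact: Xunit.
(* The section may send [sigma T s] to a point other than s, namely when s is right-scattered and
   [sigma T s] is right-dense. Since G sees s only through [sigma T s], the realization identity is
   applied at the point chosen by the section instead of s. *)
- move=> t s Tt Ts; rewrite -(sigma_sectionK Ts).
  have Tss := ts_sigma cT uT s.
  have [Tp _] := sigma_section_spec Tss.
  rewrite GE// (transition_matrixE cT uT rdA regA Ts0 solX)//; last exact: ts_sigma.
  by rewrite sigma_sectionK// !mulmxA.
Qed.

Theorem theorem4p2 (R : realType) (T : set R) (q r : nat)
    (G : R -> R -> 'M[R]_(q, r)) :
  time_scale T -> unbounded_above T -> bounded_graininess T ->
  (realizable T G <->
   exists n : nat, (0 < n)%N /\
     exists (H : R -> 'M[R]_(q, n)) (F : R -> 'M[R]_(n, r)),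
       [/\ rd_continuous T H, rd_continuous T F &
           forall t s, T t -> T s -> G t (sigma T s) = H t *m F (sigma T s)]).
Proof.
move=> [_ cT] uT _; split=> [[n [n0 [A [B [C ABC]]]]]|[n [n0 [H [F [rdH rdF GHF]]]]]].
  by exists n; split => //; exact: factorization_of_realization cT uT ABC.
exists n; split => //; exists (fun=> 0), (fun s => F (sigma T s)), H.
exact: realizable_of_factorization.
Qed.
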